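(* If $X$ is a Lindelöf $\Sigma$-space such that $\Delta^c_X=(X\times X)\setminus\Delta_X$ is discretely Lindelöf, then $X$ has a countable network.
   Context: All spaces are topological spaces assumed to be $T_1$. $\Delta_X=\{(x,x):x\in X\}$ is the diagonal of $X$. A space is Lindelöf if every open cover has a countable subcover. A space $Z$ is discretely Lindelöf if the closure (in $Z$) of every discrete subset $D\subset Z$ (i.e. $D$ discrete in its subspace topology) is Lindelöf. A family $\mathcal{F}$ of subsets of $X$ is a network modulo a cover $\mathcal{C}$ of $X$ if for any $C\in\mathcal{C}$ and any open $U\supset C$ there exists $F\in\mathcal{F}$ such that $C\subset F\subset U$. A Tychonoff space $X$ is a Lindelöf $\Sigma$-space if there exists a countable family $\mathcal{F}$ of subsets of $X$ that is a network modulo a cover $\mathcal{C}$ of $X$ consisting of compact sets. A family $\mathcal{N}$ of subsets of $X$ is a network of $X$ if every open subset of $X$ is the union of some subfamily of $\mathcal{N}$. *)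

(* Defs.v *)
From mathcomp Require Import all_boot.
From mathcomp Require Import boolp classical_sets functions cardinality.
From mathcomp Require Import reals topology separation_axioms normedtype.

Set Implicit Arguments.
Unset Strict Implicit.
Unset Printing Implicit Defensive.

Local Open Scope classical_set_scope.

(* Throughout, a set [A : set Z] used as a topological space is the type
   [set_type A] with the subspace topology (initial for the inclusion). *)

Definition open_cover (Z : topologicalType) (U : set (set Z)) : Prop :=
  U `<=` open /\ cover U id = [set: Z].

Definition lindelof_space (Z : topologicalType) : Prop :=
  forall U : set (set Z), open_cover U ->
    exists V : set (set Z), [/\ V `<=` U, countable V & cover V id = [set: Z]].

Definition discrete_space (Z : topologicalType) : Prop :=
  forall A : set Z, open A.

Definition discretely_lindelof (Z : topologicalType) : Prop :=
  forall D : set Z, discrete_space (set_type D) ->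
    lindelof_space (set_type (closure D)).

(* The library states complete regularity with uniform separators; by
   [uniform_separatorP] this is separation of points from closed sets by
   continuous functions into [0, 1]. *)
Definition tychonoff_space (X : topologicalType) : Prop :=
  accessible_space X /\ completely_regular_space X.

Definition network_modulo (X : topologicalType) (F C : set (set X)) : Prop :=
  forall K U : set X, C K -> open U -> K `<=` U ->
    exists2 A, F A & K `<=` A /\ A `<=` U.

Definition lindelof_sigma_space (X : topologicalType) : Prop :=
  tychonoff_space X /\
  exists F C : set (set X),
    [/\ countable F, C `<=` compact, cover C id = [set: X] &
        network_modulo F C].

Definition network (X : topologicalType) (N : set (set X)) : Prop :=
  forall U : set X, open U -> exists2 M, M `<=` N & U = cover M id.

Definition has_countable_network (X : topologicalType) : Prop :=
  exists2 N : set (set X), countable N & network N.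

(* Main.v *)
Require Import Defs.
From mathcomp Require Import all_boot.
From mathcomp Require Import boolp classical_sets functions cardinality.
From mathcomp Require Import reals topology separation_axioms normedtype wochoice.

(** The proof covers the pairs of distinct points that lie in a common member
    of the compact cover by countably many _separating rectangles_ [U `*` V],
    [U] and [V] open with disjoint closures. Once this is done the sets
    [A `&` U_1 `&` ... `&` U_n], with [A] in the network modulo the compact
    cover and [U_i] first sides of chosen rectangles, form a network
    ([countable_network_of_separation]): given [x] in [K `&` O], finitely many
    second sides [V_i] cover the compact set [K `\` O] while [x] lies in all the
    [U_i].

    Discreteness enters through [free_sequence]. If countably many members of
    an open cover [O] of a discretely Lindelof set [Z] never cover [S `<=` Z],
    then a recursion of length omega_1 picks points [z_i] of [S] and countable
    families [G_i `<=` O], such that [G_i] covers the closure in [Z] of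
    [{z_j | j < i}] and no later [z_k] lies in the union of [G_i]. The whole
    sequence is then relatively discrete, so its closure in [Z] is Lindelof.

    The lemma is applied three times, each time to reach a contradiction.

    - In the complement of a point [p], it shows that a compact [K] has
      countable tightness, in the form that subsets of [K] closed under limits
      of countable sets are closed ([compact_omega_closed]). A cluster point [r]
      of the free sequence is adherent to none of its initial segments; but
      [r] is a G_delta point of the closure of the sequence, and compactness
      makes [r] adherent to a countable part of it. Countable tightness passes to
      [K `*` K] ([compact_omega_closed_prod]).

    - In the complement of the diagonal, it shows that the distinct pairs of a
      single compact [K] are covered by countably many separating rectangles
      ([compact_countably_separated]): by countable tightness the closure of
      the sequence is the union of the closures of its initial segments, so it
      is covered by the [G_i]; a countable subcover uses boundedly many [i],
      hence misses the later points of the sequence.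

    - Again in the complement of the diagonal, with all members of the compact
      cover at once ([sigma_countably_separated]): let [z_i] belong to
      [K_i `*` K_i] and let [G_i] also contain countably many rectangles separating
      the points of [K_i]. Some rectangle [R] contains uncountably many [z_i].
      The square [K_i `*` K_i] lies in the union of these rectangles for [i]
      and the open complement of the closure of [R], so a member [A_i] of the network
      with [K_i `<=` A_i] has its square inside that set too. For [z_i], [z_j] in
      [R] with [i < j], the pair [z_j] lies outside that set, so [A_i] does not
      contain [K_j] and [A_i <> A_j]. This contradicts the countability of
      the network. *)

Set Implicit Arguments.
Unset Strict Implicit.
Unset Printing Implicit Defensive.

Local Open Scope classical_set_scope.

(** * Countable sets and recursion of length omega_1 *)

Lemma countable_image (T U : Type) (f : T -> U) (A : set T) :
  countable A -> countable (f @` A).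
Proof. by apply: sub_countable; apply: card_image_le. Qed.

Lemma countable_subset (T : Type) (A B : set T) :
  A `<=` B -> countable B -> countable A.
Proof. by move=> AB; apply: sub_countable; apply: subset_card_le. Qed.

Lemma countableU (T : Type) (A B : set T) :
  countable A -> countable B -> countable (A `|` B).
Proof.
move=> cA cB.
apply: (@countable_subset _ _ (\bigcup_(b in [set: bool]) if b then A else B)).
  by move=> x [Ax|Bx]; [exists true|exists false].
by apply: bigcup_countable => // -[].
Qed.

(** Countable subcovers by images, or countable subsets of an image, are pulled
    back through this lemma to the indices. *)
Lemma countable_image_preimage (T U : Type) (f : T -> U) (A : set T)
    (B : set U) : B `<=` f @` A -> countable B ->
  exists A', [/\ A' `<=` A, countable A' & f @` A' = B].
Proof.
move=> BA cB.
have /boolp.choice[g gP] : forall b : B, exists a, A a /\ f a = set_val b.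
  by move=> b; have [a Aa fa] := BA _ (set_valP b); exists a.
exists (range g); split.
- by move=> _ [b _ <-]; have [] := gP b.
- apply: countable_image; move: cB; rewrite -(eq_countable (card_setT B)) //.
- apply/seteqP; split=> [_ [_ [b _ <-] <-]|b Bb].
    by have [_ ->] := gP b; exact: set_valP.
  exists (g (exist _ b (mem_set Bb))); first by exists (exist _ b (mem_set Bb)).
  by have [_ ->] := gP (exist _ b (mem_set Bb)).
Qed.

(** These clauses characterize the order type omega_1; transitivity follows from
    well-foundedness and totality. *)
Definition omega1_order (I : Type) (lt : I -> I -> Prop) : Prop :=
  [/\ well_founded lt,
      forall i j, [\/ lt i j, i = j | lt j i],
      forall i, countable [set j | lt j i] &
      ~ countable [set: I]].

(** In a well-ordering of the uncountable type [set nat], the elements with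
    countably many predecessors form an initial segment; if it were countable,
    the least element outside it would belong to it. *)
Lemma exists_omega1_order :
  exists (I : Type) (lt : I -> I -> Prop), omega1_order lt.
Proof.
have [R wo] := well_ordering_principle (set nat).
have least (A : set (set nat)) : A !=set0 ->
    exists2 m, A m & forall x, A x -> R m x.
  move=> [x Ax]; have [|m [[mA lbm] _]] := wo (mem A).
    by exists x; apply/mem_set.
  exists m; first by apply/set_mem.
  by move=> y Ay; apply: lbm; apply/mem_set.
have anti x y : R x y -> R y x -> x = y.
  move=> xy yx; have [|m [_ uniqm]] := wo (mem [set x; y]).
    by exists x; apply/mem_set; left.
  have self z : R z z by have [|m' -> ->] := least [set z]; first by exists z.
  rewrite -(uniqm x) 1?(uniqm y) //; split.
  - by apply/mem_set; right.
  - by move=> z /set_mem [->|->].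
  - by apply/mem_set; left.
  - by move=> z /set_mem [->|->].
pose lt x y := R x y /\ x <> y.
have wf : well_founded lt.
  move=> x; apply: contrapT => nx.
  have [|m nm lbm] := least [set z | ~ Acc lt z]; first by exists x.
  apply: nm; constructor => y [ym neq]; apply: contrapT => ny.
  by apply: neq; apply: anti => //; apply: lbm.
have tot x y : [\/ lt x y, x = y | lt y x].
  have [->|/eqP xy] := eqVneq x y; first by constructor 2.
  have [|m + lbm] := least [set x; y]; first by exists x; left.
  case=> /= e; subst m.
    by constructor 1; split=> //; apply: lbm; right.
  by constructor 3; split; [apply: lbm; left|apply: nesym].
have uncount : ~ countable [set: set nat].
  move=> /countable_injP [f finj].
  (* Cantor's diagonal set for a putative injection [f] into [nat] *)
  pose D := [set n | exists2 A : set nat, f A = n & ~ A n].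
  have /= [nD|] := pselect (D (f D)).
    have [A fA nA] := nD; apply: nA.
    by rewrite (finj A D) ?inE.
  by move=> nD; apply: (nD); exists D.
pose S := [set x | countable [set y | lt y x]].
exists {x | S x}, (fun x y => lt (sval x) (sval y)); split.
- move=> [x Sx]; elim: (wf x) Sx => {}x _ IH Sx.
  by constructor => -[y Sy] yx; apply: IH.
- move=> [x Sx] [y Sy]; case: (tot x y) => /= h.
  + by constructor 1.
  + by constructor 2; apply: eq_exist.
  + by constructor 3.
- move=> [x Sx] /=; apply/countable_injP.
  have /countable_injP[f finj] := Sx.
  exists (fun u => f (sval u)) => -[u Su] [v Sv] /set_mem/= lu /set_mem/= lv.
  by move=> fuv; apply: eq_exist; apply: finj => //; apply/mem_set.
- move=> cI; have cS : countable S.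
    apply: countable_subset (countable_image sval cI).
    by move=> x Sx; exists (exist _ x Sx).
  have [|m nSm lbm] := least (~` S).
    apply/set0P/eqP => /(congr1 setC); rewrite setCK setC0 => ST.
    by apply: uncount; rewrite -ST.
  apply: nSm; apply: countable_subset cS => y [ym neq].
  by apply: contrapT => nSy; apply: neq; apply: anti => //; apply: lbm.
Qed.

(** An unbounded countable [A] would exhibit the whole order as a countable union
    of countable initial segments. *)
Lemma omega1_bounded (I : Type) (lt : I -> I -> Prop) (A : set I) :
  omega1_order lt -> countable A -> exists j, forall i, A i -> lt i j.
Proof.
move=> [_ tot cseg unc] cA; apply: contrapT => nbd; apply: unc.
apply: (@countable_subset _ _ (\bigcup_(i in A) ([set i] `|` [set j | lt j i]))).
  move=> j _; apply: contrapT => nj; apply: nbd; exists j => i Ai.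
  case: (tot i j) => // [ij|ji]; case: nj; exists i => //; [left|right] => //.
apply: bigcup_countable => // i _; apply: countableU => //; exact: countable1.
Qed.

(** The relation [P] sees only the set of the earlier values, not their order;
    a later choice that must remember earlier data carries it in [D]. *)
Lemma omega1_recursion (I : Type) (lt : I -> I -> Prop) (D : Type)
    (P : set D -> D -> Prop) : omega1_order lt ->
  (forall B, countable B -> exists x, P B x) ->
  exists a : I -> D, forall i, P (a @` [set j | lt j i]) (a i).
Proof.
move=> [wf _ cseg _] ex; have [x0 _] := ex set0 (countable0 _).
have /boolp.choice[g gP] : forall B, exists x, countable B -> P B x.
  move=> B; have [cB|ncB] := pselect (countable B); last by exists x0.
  by have [x Px] := ex B cB; exists x.
pose step i (f : forall j, lt j i -> D) :=
  g [set x | exists j (h : lt j i), f j h = x].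
pose a := Fix wf (fun _ => D) step.
have aE i : a i = g (a @` [set j | lt j i]).
  rewrite /a Fix_eq; last first.
    move=> j f f' ff'; congr (g _); apply/seteqP; split=> x [k [h <-]];
      by exists k, h.
  congr (g _); apply/seteqP; split=> x /=.
    by move=> [j [h <-]]; exists j.
  by move=> [j h <-]; exists j, h.
exists a => i; rewrite aE; apply: gP; apply: countable_image; exact: cseg.
Qed.

(** * Free sequences in discretely Lindelof sets *)

(** The discrete Lindelof property of a subspace, read in the ambient space: here
    [closure D `&` Z] is the closure of [D] in [Z]. *)
Definition discretely_lindelof_in (Y : topologicalType) (Z : set Y) : Prop :=
  forall (D : set Y) (O : set (set Y)),
    D `<=` Z -> D `<=` isolated D -> O `<=` open ->
    closure D `&` Z `<=` cover O id ->
    exists V, [/\ V `<=` O, countable V & closure D `&` Z `<=` cover V id].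

Lemma discretely_lindelof_inP (Y : topologicalType) (Z : set Y) :
  discretely_lindelof (set_type Z) -> discretely_lindelof_in Z.
Proof.
move=> dl D O DZ discD opO cov.
pose D' : set (set_type Z) := set_val @^-1` D.
have discD' : discrete_space (set_type D').
  move=> A; rewrite openE => x Ax.
  have Dx : D (set_val (set_val x)) by have := set_valP x.
  have [_ [V nV VD]] := discD _ Dx.
  have nV' : nbhs (set_val x) (set_val @^-1` V) by exact: initial_continuous.
  have nV'' : nbhs x (set_val @^-1` (set_val @^-1` V)).
    by have := @initial_continuous (set_type D') _ set_val x _ nV'.
  apply: filterS nV'' => y /= Vy.
  suff yx : y = x by rewrite /= yx.
  apply/val_inj/val_inj; have : (V `&` D) (set_val (set_val y)).
    by split=> //; have := set_valP y.
  by rewrite VD.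
pose up (W : set Y) : set (set_type (closure D')) := set_val @^-1` (set_val @^-1` W).
have clD' y : closure D' y -> closure D (set_val y).
  move=> cy B nB; have nB' : nbhs y (set_val @^-1` B) by exact: initial_continuous.
  by have [z [Dz Bz]] := cy _ nB'; exists (set_val z).
have clD y : closure D (set_val y) -> closure D' y.
  move=> cy B [W [[W0 oW0 <-] W0y W0B]].
  have [|z [Dz W0z]] := cy W0; first exact: open_nbhs_nbhs.
  exists (exist _ z (mem_set (DZ _ Dz))); split => //.
  exact: W0B.
have [|V [VO cV cV']] := dl D' discD' (up @` O).
  split.
    move=> _ [W OW <-]; apply: open_comp => [? _|].
      exact: initial_continuous.
    apply: open_comp => [? _|]; first exact: initial_continuous.
    exact: opO.
  apply/seteqP; split=> // x _.
  have [|W OW Wx] := cov (set_val (set_val x)).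
    split; first by apply: clD'; have := set_valP x.
    exact: set_valP.
  by exists (up W) => //; exists W.
have [V' [V'O cV'' eV]] := countable_image_preimage VO cV.
exists V'; split=> // y [cy Zy].
pose y1 : set_type Z := exist _ y (mem_set Zy).
have cy1 : closure D' y1 by apply: clD.
pose y2 : set_type (closure D') := exist _ y1 (mem_set cy1).
have : [set: set_type (closure D')] y2 by [].
rewrite -cV' -eV => -[W' [W VW <-] Wy].
by exists W.
Qed.

(** Discreteness of the initial segments is what makes their closures Lindelof
    and lets the recursion continue; it holds because the union of [G i], minus
    the closure of the earlier points, is a neighborhood of [z i] that contains
    no other point of the sequence. The families [sep (z i)] let an application
    add its own members of [O] at each step. *)
Lemma free_sequence (I : Type) (lt : I -> I -> Prop) (Y : topologicalType)
    (Z S : set Y) (O : set (set Y)) (sep : Y -> set (set Y)) :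
  omega1_order lt -> discretely_lindelof_in Z ->
  O `<=` open -> Z `<=` cover O id -> S `<=` Z ->
  (forall z, S z -> sep z `<=` O /\ countable (sep z)) ->
  ~ (exists V, [/\ V `<=` O, countable V & S `<=` cover V id]) ->
  exists (z : I -> Y) (G : I -> set (set Y)),
    [/\ forall i, S (z i), range z `<=` isolated (range z),
        forall i, [/\ G i `<=` O, sep (z i) `<=` G i &
          closure (z @` [set j | lt j i]) `&` Z `<=` cover (G i) id] &
        forall i j, lt i j -> ~ cover (G i) id (z j)].
Proof.
move=> om dl opO ZO SZ sepP notcov.
have [wf tot cseg _] := om.
have [s0 Ss0] : S !=set0.
  apply/set0P/eqP => S0; apply: notcov; exists set0; split=> //.
  by rewrite S0.
(* A stage is a point with its countable family. The demand on a new stage [x]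
   is conditional, since an arbitrary countable set [B] of earlier stages need
   not be discrete; [gd] discharges the conditions along the sequence. *)
pose P (B : set (Y * set (set Y))) (x : Y * set (set Y)) :=
  let D := fst @` B in
  (D `<=` Z -> D `<=` isolated D -> (forall b, B b -> countable b.2 /\ b.2 `<=` O) ->
  [/\ S x.1, x.2 `<=` O /\ countable x.2, sep x.1 `<=` x.2,
      cover x.2 id x.1 /\ closure D `&` Z `<=` cover x.2 id &
      ~ closure D x.1 /\ forall b, B b -> ~ cover b.2 id x.1]).
have exP B : countable B -> exists x, P B x.
  move=> cB; rewrite /P; set D := fst @` B.
  have [DZ|?] := pselect (D `<=` Z); last by exists (s0, set0).
  have [dD|?] := pselect (D `<=` isolated D); last by exists (s0, set0).
  have [hB|?] := pselect (forall b, B b -> countable b.2 /\ b.2 `<=` O);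
    last by exists (s0, set0).
  have [|V [VO cV covV]] := dl D O DZ dD opO; first by move=> x [_ /ZO].
  pose V' := V `|` \bigcup_(b in B) b.2.
  have [z Sz nz] : exists2 z, S z & ~ cover V' id z.
    apply: contrapT => nz; apply: notcov; exists V'; split.
    - by move=> W [/VO //|[b /hB[_ +] bW]]; apply.
    - by apply: countableU => //; apply: bigcup_countable => // b /hB[].
    - by move=> z Sz; apply: contrapT => n; apply: nz; exists z.
  have [W OW Wz] := ZO _ (SZ _ Sz).
  have [sO sc] := sepP _ Sz.
  exists (z, V `|` sep z `|` [set W]) => _ _ _; split=> //=.
  - split; first by move=> U [[/VO|/sO]|->].
    by apply: countableU; [exact: countableU|exact: countable1].
  - by move=> U sU; left; right.
  - split; first by exists W => //; right.
    by move=> x /covV[U VU Ux]; exists U => //; left; left.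
  - split=> [cz|b Bb [U bU Uz]]; last first.
      by apply: nz; exists U => //; right; exists b.
    by have [|U VU Uz] := covV z; [split=> //; exact: SZ|apply: nz; exists U => //; left].
have [a aP] := omega1_recursion om exP.
pose seg i := [set j | lt j i].
have imE i : fst @` (a @` seg i) = (fst \o a) @` seg i by rewrite image_comp.
pose good i := [/\ S (a i).1, (a i).2 `<=` O /\ countable (a i).2,
      sep (a i).1 `<=` (a i).2,
      cover (a i).2 id (a i).1 /\
      closure ((fst \o a) @` seg i) `&` Z `<=` cover (a i).2 id &
      ~ closure ((fst \o a) @` seg i) (a i).1 /\
      forall j, lt j i -> ~ cover (a j).2 id (a i).1].
have iso (A : set I) : (forall i, A i -> good i) ->
    (fst \o a) @` A `<=` isolated ((fst \o a) @` A).
  move=> gA x [i Ai <-]; split; first by apply/mem_set; exists i.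
  have [_ [GO _] _ [ci _] [ncl _]] := gA _ Ai.
  exists (cover (a i).2 id `&` ~` closure ((fst \o a) @` seg i)).
    apply: open_nbhs_nbhs; split=> //; apply: openI.
      by apply: bigcup_open => W /GO /opO.
    exact/closed_openC/closed_closure.
  apply/seteqP; split; last first.
    by move=> _ ->; split=> //; exists i.
  move=> y [[cj nj] [j Aj ay]]; rewrite -{}ay /= in cj nj *.
  case: (tot i j) => [ij|-> //|ji].
  - by have [_ _ _ _ [_ /(_ _ ij)]] := gA _ Aj.
  - by exfalso; apply: nj; apply: subset_closure; exists j.
have gd i : good i.
  elim: (wf i) => {}i _ IH.
  have := aP i; rewrite /P imE => /(_ _ _ _)[].
  - by move=> _ [j /IH[Sj _ _ _ _] <-]; exact: SZ.
  - by apply: iso.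
  - by move=> _ [j /IH[_ [? ?] _ _ _] <-].
  - move=> Si Oi si ci [nci nbi]; split=> //; split=> // j ji.
    by apply: nbi; exists j.
exists (fst \o a), (snd \o a); split.
- by move=> i; have [] := gd i.
- by apply: iso => i _.
- by move=> i; have [_ [? ?] ? [_ ?] _] := gd i.
- by move=> i j ij; have [_ _ _ _ [_ /(_ _ ij)]] := gd j.
Qed.

(** * Separation *)

(** A uniformly separating entourage gives a coarser uniform topology in which
    the neighborhood [A] persists, and uniform spaces are regular. *)
Lemma tychonoff_regular (X : topologicalType) :
  tychonoff_space X -> regular_space X.
Proof.
move=> [_ cr] x A xA.
have [||uT [E [entE E0 coarse]]] := cr x (~` A°).
- exact/open_closedC/open_interior.
- by move=> nA; apply: nA.
have xE : @nbhs _ (Uniform.Pack uT) x (xsection E x) by exact: nbhs_entourage.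
have [U xU UE] := @uniform_regular (Uniform.Pack uT) x _ xE.
exists U; first exact: coarse.
move=> y cUy; apply: interior_subset.
have Ey : E (x, y).
  have : xsection E x y by apply: UE => B nB; apply: cUy; exact: coarse.
  by move=> /xsectionP.
apply: contrapT => nAy; have : ([set x] `*` ~` A° `&` E) (x, y) by [].
by rewrite E0.
Qed.

(** The Urysohn (T2 1/2) separation axiom. *)
Definition closed_separated (X : topologicalType) : Prop :=
  forall x y : X, x <> y -> exists U V : set X,
    [/\ open U, open V, U x, V y & closure U `&` closure V = set0].

Lemma tychonoff_closed_separated (X : topologicalType) :
  tychonoff_space X -> closed_separated X.
Proof.
move=> tX x y xy; have reg := tychonoff_regular tX; have [T1 _] := tX.
have opy : nbhs x (~` [set y]).
  apply: open_nbhs_nbhs; split=> //.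
  exact/closed_openC/accessible_closed_set1.
have [U xU Uy] := reg _ _ opy.
have yU : nbhs y (~` closure U).
  apply: open_nbhs_nbhs; split; first exact/closed_openC/closed_closure.
  by move=> /Uy; apply.
have [V yV VU] := reg _ _ yU.
exists U°, V°; split; [exact: open_interior|exact: open_interior| | |].
- exact: xU.
- exact: yV.
apply/seteqP; split=> // z [zU zV].
apply: (VU z); first by apply: closureS zV; exact: interior_subset.
by apply: closureS zU; exact: interior_subset.
Qed.

Lemma closed_separated_hausdorff (X : topologicalType) :
  closed_separated X -> hausdorff_space X.
Proof.
move=> sep; rewrite open_hausdorff => x y /eqP /sep[U [V [oU oV Ux Vy UV]]].
exists (U, V); first by split; apply/mem_set.
split=> //; apply/eqP/seteqP; split=> // z [Uz Vz].
by rewrite -UV; split; exact: subset_closure.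
Qed.

(** The slice [X * {p}] meets the complement of the diagonal in a relatively
    closed copy of the complement of [p]. *)
Lemma punctured_discretely_lindelof (X : topologicalType) (p : X) :
  accessible_space X ->
  discretely_lindelof_in (~` diagonal : set (X * X)) ->
  discretely_lindelof_in (~` [set p]).
Proof.
move=> T1 dl D O Dp discD opO cov.
pose f (x : X) := (x, p).
have cf : continuous f.
  by move=> x; apply: cvg_pair; [exact: cvg_id|exact: cvg_cst].
have cfst : continuous (fst : X * X -> X) by move=> x; exact: cvg_fst.
have csnd : continuous (snd : X * X -> X) by move=> x; exact: cvg_snd.
pose up (W : set X) : set (X * X) := fst @^-1` W.
have [||||V [VO cV covV]] := dl (f @` D) (up @` O).
- by move=> _ [x Dx <-] /= xp; exact: (Dp x).
- move=> _ [x Dx <-]; split; first by apply/mem_set; exists x.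
  have [_ [W xW WD]] := discD _ Dx.
  exists (fst @^-1` W); first exact: (cfst (f x)).
  apply/seteqP; split; last first.
    move=> _ ->; split; last by exists x.
    exact: (nbhs_singleton xW).
  move=> y [Wz [z Dz yz]]; rewrite -{}yz /= in Wz *.
  by have : (W `&` D) z by []; rewrite WD => ->.
- by move=> _ [W /opO oW <-]; exact: open_comp.
- move=> [x y] [cxy nxy].
  have cx : closure D x.
    move=> B xB; have [|[z1 z2] [[z Dz [<- _]] Bz]] := cxy (fst @^-1` B).
      exact: (cfst (x, y)).
    by exists z.
  have yp : y = p.
    apply: (accessible_closed_set1 T1) => B yB.
    by have [|_ [[z _ <-] Bp]] := cxy (snd @^-1` B);
      [exact: (csnd (x, y))|exists p].
  have [|W OW Wx] := cov x.
    by split=> // xp; apply: nxy; rewrite /diagonal /= yp.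
  by exists (up W) => //; exists W.
have [V' [V'O cV' eV]] := countable_image_preimage VO cV.
exists V'; split=> // x [cx xp]; have [|W' VW' W'x] := covV (f x).
  split; last by move=> /= /xp.
  move=> B /cf xB; have [z [Dz Bz]] := cx _ xB.
  by exists (f z); split=> //; exists z.
by move: VW' W'x; rewrite -eV => -[W V'W <-] Wx; exists W.
Qed.

(** * Countable tightness of compact sets *)

(** The members of [W] have closures avoiding [r], so a sequence in [S] can avoid
    more and more of them; its cluster points avoid them all. *)
Lemma countable_cluster (X : topologicalType) (K S : set X) (r : X)
    (W : set (set X)) :
  compact K -> S `<=` K -> closure S r -> countable W ->
  (forall U, W U -> open U /\ ~ closure U r) ->
  exists E s, [/\ E `<=` S, countable E, closure E s & ~ cover W id s].
Proof.
move=> cK SK Sr cW sepW; have /countable_injP[f finj] := cW.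
have avoid n : nbhs r [set x | forall U, W U -> (f U < n)%N -> ~ U x].
  elim: n => [|n IH]; first by apply: nearW => x U _.
  have [[U [WU fU]]|noU] := pselect (exists U, W U /\ f U = n); last first.
    apply: filterS IH => x xU U WU; rewrite ltnS leq_eqVlt => /orP[/eqP e|].
      by exfalso; apply: noU; exists U.
    exact: xU.
  have rU : nbhs r (~` closure U).
    apply: open_nbhs_nbhs; split; last by case: (sepW _ WU).
    exact/closed_openC/closed_closure.
  apply: filterS2 IH rU => x xU nUx V WV; rewrite ltnS leq_eqVlt.
  case/orP => [/eqP fV|]; last exact: xU.
  have -> : V = U by apply: finj; rewrite ?inE// fV.
  by move=> Ux; apply: nUx; exact: subset_closure.
have /boolp.choice[d dP] : forall n, exists x, S x /\
    forall U, W U -> (f U < n)%N -> ~ U x.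
  by move=> n; have [x [Sx xP]] := Sr _ (avoid n); exists x.
have [|s [Ks cs]] := cK (d @ \oo) _.
  by exists 0%N => // n _; apply: SK; case: (dP n).
exists (range d), s; split.
- by move=> _ [n _ <-]; case: (dP n).
- exact: countable_image.
- move=> B sB; apply: cs => //; by exists 0%N => // n _; exists n.
- move=> [U WU Us]; have [oU _] := sepW _ WU.
  have [||x [nUx Ux]] := cs (~` U) U; last exact: nUx.
  + exists (f U).+1 => // n /= fn; have [_ h] := dP n; exact: h.
  + exact: open_nbhs_nbhs.
Qed.

(** Countable tightness of a space is the statement that its omega-closed subsets
    are closed; this form passes to products more easily than the one with
    adherent points. *)
Definition omega_closed (X : topologicalType) (A : set X) : Prop :=
  forall E, E `<=` A -> countable E -> closure E `<=` A.

Lemma closed_separated_cover (X : topologicalType) (p : X) :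
  closed_separated X ->
  ~` [set p] `<=` cover [set W | open W /\ ~ closure W p] id.
Proof.
move=> sep x /= xp; have [U [V [oU oV Ux Vp UV]]] := sep _ _ xp.
exists U => //; split=> // cUp.
have : (closure U `&` closure V) p by split=> //; exact: subset_closure.
by rewrite UV.
Qed.

(** For a limit [p] of [A] outside [A], a free sequence in [A] for the cover of the
    complement of [p] by open sets whose closure avoids [p] has a cluster point
    [r] outside the closures of all its initial segments. The Lindelof closure of the
    sequence in the complement of [r] makes [r] a G_delta in it, so [r] is adherent to
    countably many points of the sequence, that is, to an initial segment. *)
Lemma compact_omega_closed (X : topologicalType) (K A : set X) :
  closed_separated X -> (forall p : X, discretely_lindelof_in (~` [set p])) ->
  compact K -> A `<=` K -> omega_closed A -> closed A.
Proof.
move=> sep dl cK AK oA p Ap; apply: contrapT => nAp.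
have [I [lt om]] := exists_omega1_order.
have [_ tot cseg unc] := om.
pose O p : set (set X) := [set W | open W /\ ~ closure W p].
have opO p' : O p' `<=` open by move=> W [].
have [|||z [G [Az disc GP zP]]] := @free_sequence I lt X (~` [set p]) A (O p)
  (fun=> set0) om (dl p) (@opO p) (closed_separated_cover sep).
- by move=> x Ax xp; apply: nAp; rewrite -xp.
- by move=> x _; split.
- move=> [V [VO cV AV]].
  have [|E [s [EA cE Es ns]]] := countable_cluster cK AK Ap cV; first exact: VO.
  by apply/ns/AV/(oA E).
pose seg i := [set j | lt j i].
(* The filter of co-countable parts of the sequence: its cluster points are
   adherent to every tail. *)
pose F := [set B : set X | countable [set i | ~ B (z i)]].
have PF : ProperFilter F.
  split.
    move=> F0; apply: unc; apply: countable_subset F0 => i _ //=.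
  split.
  - apply: countable_subset (countable0 I) => i /=; exact.
  - move=> B C FB FC; apply: countable_subset (countableU FB FC) => i /=.
    by move/not_andP.
  - move=> B C BC; apply: countable_subset => i /= nC /BC; exact.
have FR B : (forall i, B (z i)) -> F B.
  by move=> Bz; apply: countable_subset (countable0 I) => i /= /(_ (Bz i)).
have [|r [Kr rP]] := cK F PF; first by apply: FR => i; exact: AK.
have rG i : ~ cover (G i) id r.
  have [GO _ _] := GP i.
  move=> Gr; have [||x []] := rP (~` cover (G i) id) (cover (G i) id).
  - apply: countable_subset (countableU (cseg i) (countable1 i)) => j /= nj.
    case: (tot i j) => [/zP //|->|]; by [right|left].
  - apply: open_nbhs_nbhs; split=> //.
    by apply: bigcup_open => W /GO[].
  - exact.
have rseg i : ~ closure (z @` seg i) r.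
  move=> ri; have [rp|rp] := pselect (r = p).
    apply: nAp; rewrite -rp; apply: oA ri; first by move=> _ [j _ <-].
    by apply: countable_image; exact: cseg.
  by apply: (rG i); have [_ _] := GP i; apply; split.
have rz i : z i <> r.
  have [j ij] := omega1_bounded om (countable1 i).
  move=> zr; apply: (rseg j); rewrite -zr; apply: subset_closure.
  by exists i => //; exact: ij.
have clr : closure (range z) r.
  by move=> B nB; apply: rP => //; apply: FR => i; exists i.
have [||V [VO cV covV]] := dl r (range z) (O r) _ disc (@opO r).
- by move=> _ [i _ <-] /rz.
- by move=> x [_ xr]; exact: closed_separated_cover.
have [||E [s [Ez cE Es ns]]] := countable_cluster cK _ clr cV.
- by move=> _ [i _ <-]; exact: AK.
- exact: VO.
have sr : s = r.
  apply: contrapT => sr; apply: ns; apply: covV; split=> //.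
  exact: closureS Es.
have [B [_ cB eB]] := countable_image_preimage Ez cE.
have [j jP] := omega1_bounded om cB.
apply: (rseg j); rewrite -sr; apply: closureS Es => x.
by rewrite -eB => -[i Bi <-]; exists i => //; exact: jP.
Qed.

(** For [(p, q)] adherent to [A], the part of [A] over a closed neighborhood of [q]
    projects onto an omega-closed, hence closed, set containing [p]. So [q] is
    adherent to the slice of [A] at [p], which is omega-closed too. *)
Lemma compact_omega_closed_prod (X : topologicalType) (K : set X)
    (A : set (X * X)) :
  hausdorff_space X -> regular_space X -> compact K ->
  (forall B, B `<=` K -> omega_closed B -> closed B) ->
  A `<=` K `*` K -> omega_closed A -> closed A.
Proof.
move=> T2 reg cK HK AK oA [p q] Apq.
have cfst : continuous (fst : X * X -> X) by move=> x; exact: cvg_fst.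
have csnd : continuous (snd : X * X -> X) by move=> x; exact: cvg_snd.
pose B := [set y | A (p, y)].
have clB : closed B.
  apply: HK => [y /AK[]//|E EB cE y Ey].
  apply: (oA [set (p, e) | e in E]).
  - by move=> _ [e /EB Be <-].
  - exact: countable_image.
  - move=> N [[N1 N2] /= [N1p N2y] N12].
    have [e [Ee N2e]] := Ey _ N2y.
    exists (p, e); split; first by exists e.
    by apply: N12; split=> //; exact: nbhs_singleton N1p.
apply: clB => V qV; have [V' qV' V'V] := reg _ _ qV.
pose A' := A `&` snd @^-1` closure V'.
have clV : closed (snd @^-1` closure V' : set (X * X)).
  apply: preimage_closed; first by move=> ? _; exact: csnd.
  exact: closed_closure.
have clC : closed (fst @` A').
  apply: HK => [_ [x [/AK[] ? ? _] <-]//|E EC cE].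
  have [E' [E'A cE' <-]] := countable_image_preimage EC cE.
  have clE' : closure E' `<=` A'.
    move=> x E'x; split; first by apply: oA E'x => // y /E'A[].
    apply: clV; apply: closureS E'x => y /E'A[] //.
  have cptE : compact (closure E').
    apply: subclosed_compact (compact_setX cK cK) _; first exact: closed_closure.
    by move=> x /clE'[/AK].
  have : closed (fst @` closure E').
    apply: compact_closed => //; apply: continuous_compact => //.
    by apply: continuous_subspaceT.
  move=> clf x cx; have : (fst @` closure E') x.
    apply: clf; apply: closureS cx; apply: image_subset; exact: subset_closure.
  by move=> [y /clE' ? <-]; exists y.
have [[x y] [Axy V'y] /= xp] : (fst @` A') p.
  apply: clC => U pU.
  have [|[x y] [Axy [Ux V'y]]] := Apq (U `*` V'); first by exists (U, V').
  exists x; split=> //; exists (x, y) => //; split=> //=; exact: subset_closure.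
by exists y; split; [rewrite /B/= -xp|exact: V'V].
Qed.

(** * Separating rectangles *)

(** If [Q K] fails, the complements relative to [K] of the sets satisfying [Q]
    generate a proper filter without cluster point in [K]. *)
Lemma compact_set_induction (X : topologicalType) (K : set X)
    (Q : set X -> Prop) :
  compact K -> Q set0 -> (forall A B, A `<=` B -> Q B -> Q A) ->
  (forall A B, Q A -> Q B -> Q (A `|` B)) ->
  (forall x, K x -> exists2 U, nbhs x U & Q U) -> Q K.
Proof.
move=> cK Q0 Qle QU loc; apply: contrapT => nQK.
pose F := [set B : set X | Q (K `\` B)].
have PF : ProperFilter F.
  split; first by rewrite /F /= setD0.
  split.
  - by rewrite /F /= setDT.
  - by move=> A B FA FB; rewrite /F /= setDIr; exact: QU.
  - move=> A B AB; apply: Qle; exact: setDS.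
have [|x [Kx xP]] := cK F PF; first by rewrite /F /= setDv.
have [U xU QU'] := loc _ Kx.
have [|y []//] := xP (~` U) U _ xU.
by apply: Qle QU' => y [_ /contrapT].
Qed.

(** Wallace's theorem for a square, by two compactness inductions: over the second
    factor with the first coordinate fixed, then over the first factor. *)
Lemma compact_square_nbhs (X : topologicalType) (K : set X) (O : set (X * X)) :
  compact K -> open O -> K `*` K `<=` O ->
  exists V, [/\ open V, K `<=` V & V `*` V `<=` O].
Proof.
move=> cK oO KO.
have tube x : K x -> exists U V, [/\ nbhs x U, open V, K `<=` V & U `*` V `<=` O].
  move=> Kx; apply: (compact_set_induction (Q := fun S => exists U V,
      [/\ nbhs x U, open V, S `<=` V & U `*` V `<=` O])) => //.
  - exists setT, set0; split=> //; [exact: filterT|exact: open0|by move=> ? []].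
  - by move=> A B AB [U [V [? ? /(subset_trans AB) ? ?]]]; exists U, V.
  - move=> A B [U [V [xU oV AV UV]]] [U' [V' [xU' oV' BV' UV']]].
    exists (U `&` U'), (V `|` V'); split.
    + exact: filterI.
    + exact: openU.
    + exact: setUSS.
    + by move=> y [[Uy U'y] [Vy|V'y]]; [apply: UV|apply: UV'].
  - move=> y Ky; have : nbhs (x, y) O by apply: open_nbhs_nbhs; split=> //; exact: KO.
    move=> [[U V] /= [xU yV] UV]; exists V°; first exact: nbhs_interior.
    exists U, V°; split=> //; first exact: open_interior.
    by move=> z [Uz Vz]; apply: UV; split=> //; exact: interior_subset.
have [U [V [oU oV KU KV UV]]] : exists U V,
    [/\ open U, open V, K `<=` U, K `<=` V & U `*` V `<=` O].
  apply: (compact_set_induction (Q := fun S => exists U V,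
      [/\ open U, open V, S `<=` U, K `<=` V & U `*` V `<=` O])) => //.
  - exists set0, setT; split=> //; [exact: open0|exact: openT|by move=> ? []].
  - by move=> A B AB [U [V [? ? /(subset_trans AB) ? ? ?]]]; exists U, V.
  - move=> A B [U [V [oU oV AU KV UV]]] [U' [V' [oU' oV' BU' KV' UV']]].
    exists (U `|` U'), (V `&` V'); split.
    + exact: openU.
    + exact: openI.
    + exact: setUSS.
    + by move=> y Ky; split; [exact: KV|exact: KV'].
    + by move=> y [[Uy|U'y] [Vy V'y]]; [apply: UV|apply: UV'].
  - move=> x /tube[U [V [xU oV KV UV]]]; exists U°; first exact: nbhs_interior.
    exists U°, V; split=> //; first exact: open_interior.
    by move=> z [Uz Vz]; apply: UV; split=> //; exact: interior_subset.
exists (U `&` V); split; first exact: openI.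
  by move=> x Kx; split; [exact: KU|exact: KV].
by move=> x [[Ux _] [_ Vx]]; exact: UV.
Qed.

(** Disjointness of the closures, not only of the sides, keeps the closure of a
    rectangle away from the diagonal. *)
Definition separating_rectangles (X : topologicalType) : set (set (X * X)) :=
  [set R | exists U V, [/\ open U, open V, closure U `&` closure V = set0 &
    R = U `*` V]].
Arguments separating_rectangles : clear implicits.

Definition countably_separated (X : topologicalType) (S : set (X * X)) : Prop :=
  exists V, [/\ V `<=` separating_rectangles X, countable V & S `<=` cover V id].

Lemma open_setX (X : topologicalType) (U V : set X) :
  open U -> open V -> open (U `*` V).
Proof.
move=> oU oV; rewrite openE => -[x y] [/= Ux Vy].
by exists (U, V) => //; split; exact: open_nbhs_nbhs.
Qed.

Lemma closed_setX (X : topologicalType) (A B : set X) :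
  closed A -> closed B -> closed (A `*` B).
Proof.
by move=> cA cB; apply: closedI; apply: preimage_closed => // x _;
  [exact: cvg_fst|exact: cvg_snd].
Qed.

Lemma separating_rectangles_open (X : topologicalType) :
  separating_rectangles X `<=` open.
Proof. by move=> _ [U [V [oU oV _ ->]]]; exact: open_setX. Qed.

Lemma separating_rectangles_cover (X : topologicalType) :
  closed_separated X -> ~` diagonal `<=` cover (separating_rectangles X) id.
Proof.
move=> sep [x y] /= xy; have [U [V [oU oV Ux Vy UV]]] := sep _ _ xy.
by exists (U `*` V) => //; exists U, V.
Qed.

(** This amounts to the metrizability of [K]. *)
Lemma compact_countably_separated (X : topologicalType) (K : set X) :
  tychonoff_space X -> discretely_lindelof_in (~` diagonal : set (X * X)) ->
  compact K -> countably_separated ((K `*` K) `&` ~` diagonal).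
Proof.
move=> tX dl cK; have sep := tychonoff_closed_separated tX.
have T2 := closed_separated_hausdorff sep; have [T1 _] := tX.
have tightK := fun A => @compact_omega_closed _ K A sep
  (fun p => punctured_discretely_lindelof T1 dl) cK.
have tightKK := fun A => @compact_omega_closed_prod _ K A T2
  (tychonoff_regular tX) cK tightK.
have [I [lt om]] := exists_omega1_order.
have [_ _ cseg _] := om.
apply: contrapT => ncs.
have [||z [G [Sz disc GP zP]]] := free_sequence om dl
  (@separating_rectangles_open X) (separating_rectangles_cover sep) _ _ ncs (sep := fun=> set0).
- by move=> x [].
- by move=> x _; split.
pose seg i := [set j | lt j i].
(* The union is omega-closed since countably many stages are bounded, hence
   closed by countable tightness of [K `*` K]. *)
pose A := \bigcup_i closure (z @` seg i).
have clKK : closed (K `*` K).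
  by apply: closed_setX; exact: compact_closed.
have clA : closed A.
  apply: tightKK.
    move=> x [i _ xi]; apply: clKK; apply: closureS xi => _ [j _ <-].
    by have [] := Sz j.
  move=> E EA cE x Ex.
  have /boolp.choice[g gP] : forall e, exists i, E e -> closure (z @` seg i) e.
    move=> e; have [/EA[i _ ei]|nE] := pselect (E e); first by exists i.
    have [i _] := omega1_bounded om (countable0 _).
    by exists i.
  have [|j jP] := omega1_bounded om (A := \bigcup_(e in E) seg (g e)).
    by apply: bigcup_countable => // e _; exact: cseg.
  have Ej : E `<=` closure (z @` seg j).
    move=> e Ee; apply: closureS (gP e Ee) => _ [i ie <-].
    by exists i => //; apply: jP; exists e.
  exists j => //; rewrite (iffLR (closure_id _) (@closed_closure _ (z @` seg j))).
  exact: closureS Ex.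
have zA : range z `<=` A.
  move=> _ [i _ <-]; have [j ij] := omega1_bounded om (countable1 i).
  exists j => //; apply: subset_closure; exists i => //; exact: ij.
have [|||V [VG cV covV]] := dl (range z) (\bigcup_i G i) _ disc.
- by move=> _ [i _ <-]; case: (Sz i).
- by move=> W [i _]; have [GO _ _] := GP i; move=> /GO /separating_rectangles_open.
- move=> x [xz xD]; have [i _ xi] := clA _ (closureS zA xz).
  have [_ _ /(_ x)[//|W GW Wx]] := GP i.
  by exists W => //; exists i.
have /boolp.choice[g gP] : forall W, exists i, V W -> G i W.
  move=> W; have [/VG[i _ GW]|nV] := pselect (V W); first by exists i.
  have [i _] := omega1_bounded om (countable0 _).
  by exists i.
have [j jP] := omega1_bounded om (countable_image g cV).
have [|W VW Wj] := covV (z j).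
  by split; [apply: subset_closure; exists j|case: (Sz j)].
apply: (zP (g W) j); first by apply: jP; exists W.
by exists W => //; exact: gP.
Qed.

(** * Lindelof Sigma-spaces *)

(** One rectangle [U `*` W] contains uncountably many points of a free sequence.
    The network property assigns members of [F] to these points, and distinct
    points receive distinct members because the families [G i] contain rectangles
    separating the compact set attached to [z i]. *)
Lemma sigma_countably_separated (X : topologicalType) (F C : set (set X)) :
  closed_separated X -> discretely_lindelof_in (~` diagonal : set (X * X)) ->
  countable F -> C `<=` compact -> network_modulo F C ->
  (forall K, C K -> countably_separated ((K `*` K) `&` ~` diagonal)) ->
  countably_separated (\bigcup_(K in C) ((K `*` K) `&` ~` diagonal)).
Proof.
move=> sep dl cF Ccpt net Csep.
set S := \bigcup_(K in C) _.
have /boolp.choice[KV KVP] : forall z, exists KV : set X * set (set (X * X)), S z ->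
    [/\ C KV.1, (KV.1 `*` KV.1) z, KV.2 `<=` separating_rectangles X,
        countable KV.2 & (KV.1 `*` KV.1) `&` ~` diagonal `<=` cover KV.2 id].
  move=> z; have [[K CK [Kz zD]]|nS] := pselect (S z); last by exists (set0, set0).
  have [V [VO cV covV]] := Csep _ CK.
  by exists (K, V).
have [I [lt om]] := exists_omega1_order.
have [_ tot cseg unc] := om.
apply: contrapT => ncs.
have [||z [G [Sz disc GP zP]]] := free_sequence om dl
  (@separating_rectangles_open X) (separating_rectangles_cover sep) _ _ ncs
  (sep := fun z => (KV z).2).
- by move=> x [K _ []].
- by move=> x /KVP[].
have [||V [VO cV covV]] := dl (range z) (separating_rectangles X) _ disc
    (@separating_rectangles_open X).
- by move=> _ [i _ <-]; have [K _ []] := Sz i.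
- by move=> x [_ xD]; exact: separating_rectangles_cover.
apply: unc; apply: (@countable_subset _ _ (\bigcup_(R in V) [set i | R (z i)])).
  move=> i _; have [|R VR Ri] := covV (z i).
    by split; [apply: subset_closure; exists i|have [K _ []] := Sz i].
  by exists R.
apply: bigcup_countable => // R /VO [U [W [oU oW UW ->]]].
(* [O i] contains [K_i `*` K_i], as the closure of [U `*` W] avoids the diagonal,
   but contains no later point of the sequence lying in [U `*` W]. *)
pose O i : set (X * X) := cover (KV (z i)).2 id `|` ~` (closure U `*` closure W).
have clR : closed (closure U `*` closure W).
  by apply: closed_setX; exact: closed_closure.
have /boolp.choice[h hP] : forall i, exists A,
    [/\ F A, (KV (z i)).1 `<=` A & A `*` A `<=` O i].
  move=> i; have [CK Kz VO' cV' covK] := KVP _ (Sz i).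
  have [|||B [oB KB BO]] := @compact_square_nbhs X (KV (z i)).1 (O i).
  - exact: Ccpt.
  - apply: openU; last exact: closed_openC.
    by apply: bigcup_open => T /VO' /separating_rectangles_open.
  - move=> x Kx; have [Rx|nRx] := pselect ((closure U `*` closure W) x); last by right.
    left; apply: covK; split=> // xD.
    have : (closure U `&` closure W) x.1 by case: Rx => ? ?; split=> //; rewrite xD.
    by rewrite UW.
  have [A FA [KA AB]] := net _ _ CK oB KB.
  by exists A; split=> // x [/AB ? /AB ?]; exact: BO.
have hlt i j : lt i j -> (U `*` W) (z j) -> h i <> h j.
  move=> ij [Uj Wj] hij; have [_ _ /(_ (z j))] := hP i.
  have [_ Kj _] := hP j; have [_ [K1 K2] _ _ _] := KVP _ (Sz j).
  case; first by rewrite hij; split; exact: Kj.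
  - move=> [T VT Tz]; apply: (zP i j) => //; exists T => //.
    by have [_ + _] := GP i; apply.
  - by apply; split; exact: subset_closure.
have /countable_injP[f finj] := cF.
apply/countable_injP; exists (f \o h) => i j /set_mem/= Ri /set_mem/= Rj fij.
have hij : h i = h j by apply: finj => //; apply/mem_set; [case: (hP i)|case: (hP j)].
by case: (tot i j) => // /hlt; [move=> /(_ Rj)|move=> /(_ Ri) /nesym].
Qed.

(** Intersecting the members of [F] with finitely many first sides of rectangles
    yields the network: the corresponding second sides cover [K `\` O]. *)
Lemma countable_network_of_separation (X : topologicalType) (F C : set (set X)) :
  countable F -> C `<=` compact -> cover C id = [set: X] -> network_modulo F C ->
  countably_separated (\bigcup_(K in C) ((K `*` K) `&` ~` diagonal)) ->
  has_countable_network X.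
Proof.
move=> cF Ccpt covC net [V [VR cV covV]].
have /boolp.choice[u uP] : forall R, exists UW : set X * set X, V R ->
    [/\ open UW.1, open UW.2, UW.1 `&` UW.2 = set0 & R = UW.1 `*` UW.2].
  move=> R; have [/VR[U [W [oU oW UW ->]]]|nV] := pselect (V R);
    last by exists (set0, set0).
  exists (U, W) => _; split=> //; apply/seteqP; split=> // x [Ux Wx].
  by rewrite -UW; split; exact: subset_closure.
pose piece (As : set X * set (set (X * X))) :=
  As.1 `&` \bigcap_(R in As.2) (u R).1.
pose N := piece @` (F `*` [set s | s `<=` V /\ finite_set s]).
exists N.
  apply: countable_image; apply: countableX => //; exact: countable_finite_subset.
move=> O oO; exists [set A | N A /\ A `<=` O]; first by move=> A [].
apply/seteqP; split; last by move=> x [A [_ AO] /AO].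
move=> x Ox; have : [set: X] x by [].
rewrite -covC => -[K CK Kx].
have cKO : compact (K `&` ~` O).
  by apply: compact_closedI; [exact: Ccpt|exact: open_closedC].
pose Q (S : set X) := exists s, [/\ s `<=` V, finite_set s,
  (\bigcap_(R in s) (u R).1) x & S `<=` \bigcup_(R in s) (u R).2].
have [s [sV fs us Ks]] : Q (K `&` ~` O).
  apply: compact_set_induction => //.
  - by exists set0; split.
  - by move=> A B AB [s [? ? ? Bs]]; exists s; split=> //; exact: subset_trans Bs.
  - move=> A B [s [sV fs us As]] [t [tV ft ut Bt]]; exists (s `|` t); split.
    + by move=> R [/sV|/tV].
    + by rewrite finite_setU.
    + by move=> R [/us|/ut].
    + by move=> y [/As[R sR Ry]|/Bt[R tR Ry]]; exists R => //; [left|right].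
  - move=> y [Ky nOy]; have [|R VR' Rxy] := covV (x, y).
      by exists K => //; split=> // xy; apply: nOy; have <- : x = y by [].
    have [oU oW UW RE] := uP _ VR'; move: Rxy; rewrite RE => -[/= Ux Wy].
    exists (u R).2; first exact: open_nbhs_nbhs.
    exists [set R]; split=> //; first by move=> _ ->.
    + by move=> _ ->.
    + by move=> w Ww; exists R.
have oU : open (O `|` \bigcup_(R in s) (u R).2).
  apply: openU => //; apply: bigcup_open => R /sV /uP[] //.
have [|A FA [KA AU]] := net _ _ CK oU.
  move=> y Ky; have [Oy|nOy] := pselect (O y); first by left.
  by right; exact: Ks.
exists (piece (A, s)); last by split; [exact: KA|exact: us].
split; first by exists (A, s).
move=> y [/AU[//|[R sR Wy]] /(_ R sR) Uy].
have [_ _ UW _] := uP _ (sV _ sR).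
by have : ((u R).1 `&` (u R).2) y by []; rewrite UW.
Qed.

Theorem corollary3p26 (X : topologicalType) :
  lindelof_sigma_space X ->
  discretely_lindelof (set_type (~` (diagonal : set (X * X)))) ->
  has_countable_network X.
Proof.
move=> [tX [F [C [cF Ccpt covC net]]]] /discretely_lindelof_inP dl.
apply: (countable_network_of_separation cF Ccpt covC net).
apply: (sigma_countably_separated _ dl cF Ccpt net).
  exact: tychonoff_closed_separated.
by move=> K /Ccpt cK; apply: compact_countably_separated => //.
Qed.
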